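(* Let $\mathcal F$ be a finite set of function symbols and let $I$ be a finite set of inequalities, each of the form $s\succ t$ or $s\succsim t$ with $s,t$ terms over $\mathcal F$ and variables $\mathcal V$. Consider either of two modes: *strict-LPO* (only strict precedences on $\mathcal F$ are admitted) or *quasi-LPO* (non-strict precedences on $\mathcal F$ are admitted). Let $\mathrm{Enc}(I)$ be the propositional encoding of $I$ for the chosen mode, as defined in the context. Then, in each of the two modes, there exist an argument filtering $\pi$ on $\mathcal F$ and an admitted precedence on $\mathcal F$ whose induced lexicographic path order satisfies $\pi(s)\succ_{LPO}\pi(t)$ for every $s\succ t$ in $I$ and $\pi(s)\succsim_{LPO}\pi(t)$ for every $s\succsim t$ in $I$, if and only if $\mathrm{Enc}(I)$ is satisfiable. Moreover, each model $M$ of $\mathrm{Enc}(I)$ corresponds to such a pair: the argument filtering $\pi_M$ and the lexicographic path order induced by the precedence read off from $M$ (as defined in the context) orient all inequalities of $I$ in this sense.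
   Context: **Argument filterings.** $\pi$ maps every $n$-ary symbol to a position $i\in\{1,\dots,n\}$ or to a (possibly empty) list $[i_1,\dots,i_p]$ with $1\le i_1<\dots<i_p\le n$. On terms: $\pi(x)=x$ for variables; $\pi(f(t_1,\dots,t_n))=\pi(t_i)$ if $\pi(f)=i$; and $=f(\pi(t_{i_1}),\dots,\pi(t_{i_p}))$ if $\pi(f)=[i_1,\dots,i_p]$. **Precedences.** A strict precedence is a strict partial order $>_{\mathcal F}$ on $\mathcal F$; in that case $\approx_{\mathcal F}$ denotes identity of symbols. A non-strict precedence is a reflexive and transitive relation $\ge_{\mathcal F}$ on $\mathcal F$; then $f>_{\mathcal F}g$ means $f\ge_{\mathcal F}g$ and not $g\ge_{\mathcal F}f$, and $f\approx_{\mathcal F}g$ means $f\ge_{\mathcal F}g$ and $g\ge_{\mathcal F}f$. **LPO.** Let $\sim$ be equality of terms up to $\approx_{\mathcal F}$-equivalence of symbols. A precedence induces: $s=f(s_1,\dots,s_n)\succ_{LPO}t$ iff (1) $t=g(t_1,\dots,t_m)$, $s\succ_{LPO}t_j$ for all $j$, and either $f>_{\mathcal F}g$, or $f\approx_{\mathcal F}g$ and $\langle s_1,\dots,s_n\rangle\succ_{LPO}^{lex}\langle t_1,\dots,t_m\rangle$; or (2) $s_i\succsim_{LPO}t$ for some $i$. Here $\succsim_{LPO}$ is the union of $\succ_{LPO}$ and $\sim$, and $\langle s_1,\dots,s_n\rangle\succ_{LPO}^{lex}\langle t_1,\dots,t_m\rangle$ iff $n>0$ and ($m=0$, or $s_1\succ_{LPO}t_1$,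 or both $s_1\succsim_{LPO}t_1$ and $\langle s_2,\dots,s_n\rangle\succ_{LPO}^{lex}\langle t_2,\dots,t_m\rangle$). Variables are never $\succ_{LPO}$-greater than anything. **Constraints.** Atoms are $f>_{\mathcal F}g$, $f\approx_{\mathcal F}g$, $\pi(f)=i$, $\pi(f)\sqsupseteq i$ ($\pi(f)$ is $i$ or a list containing $i$), and $list(\pi(f))$ ($\pi(f)$ is a list). The map $\tau$ sends inequalities to Boolean combinations of atoms. Below $x,y$ are variables, $s=f(s_1,\dots,s_n)$; empty disjunctions are false, empty conjunctions true. *$\tau$ for $\succ$, strict-LPO mode:* $\tau(x\succ t)=\mathit{false}$, and $\tau(s\succ t)=\tau_{1a}(s\succ t)\vee\tau_{1b}(s\succ t)\vee\tau_2(s\succ t)$ where - $\tau_{1a}(s\succ x)=\tau_{1b}(s\succ x)=\mathit{false}$; - $\tau_{1a}(s\succ g(t_1,\dots,t_m))=\bigvee_{j}\big(\pi(g)=j\ \wedge\ \tau(s\succ t_j)\big)$; - for $f\ne g$: $\tau_{1b}(s\succ g(t_1,\dots,t_m))=list(\pi(f))\wedge list(\pi(g))\wedge(f>_{\mathcal F}g)\wedge\bigwedge_{j}\big(\pi(g)\sqsupseteq j\to\tau(s\succ t_j)\big)$; - $\tau_{1b}(s\succ f(t_1,\dots,t_n))=list(\pi(f))\wedge\tau(\langle s_1,\dots,s_n\rangle\succ^{lex}_f\langle t_1,\dots,t_n\rangle)\wedge\bigwedge_{j}\big(\pi(f)\sqsupseteq j\to\tau(s\succ t_j)\big)$; - $\tau_2(s\succ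 t)=\bigvee_i\big(\pi(f)=i\wedge\tau(s_i\succ t)\big)\vee\big(list(\pi(f))\wedge\bigvee_i(\pi(f)\sqsupseteq i\wedge\tau(s_i\succsim t))\big)$; - $\tau(\langle\rangle\succ^{lex}_f\langle\rangle)=\mathit{false}$, and for $i\le n$: $\tau(\langle s_i,\dots,s_n\rangle\succ^{lex}_f\langle t_i,\dots,t_n\rangle)=\big(\pi(f)\sqsupseteq i\wedge\tau(s_i\succ t_i)\big)\vee\Big(\big(\pi(f)\sqsupseteq i\to\tau(s_i\succsim t_i)\big)\wedge\tau(\langle s_{i+1},\dots,s_n\rangle\succ^{lex}_f\langle t_{i+1},\dots,t_n\rangle)\Big)$. *$\tau$ for $\succsim$, strict-LPO mode:* $\tau(x\succsim x)=\mathit{true}$; $\tau(x\succsim y)=\mathit{false}$ for $x\neq y$; $\tau(x\succsim g(t_1,\dots,t_m))=\bigvee_j(\pi(g)=j\wedge\tau(x\succsim t_j))$; and $\tau(s\succsim t)=\tau_{1a}(s\succsim t)\vee\tau_{1b}(s\succsim t)\vee\tau_2(s\succsim t)$, given by the same clauses as for $\succ$ with the following replacements: in $\tau_{1a}$, $\tau(s\succ t_j)$ becomes $\tau(s\succsim t_j)$; in $\tau_2$, $\tau(s_i\succ t)$ becomes $\tau(s_i\succsim t)$; in $\tau_{1b}$, $\succ^{lex}_f$ becomes $\succsim^{lex}_f$ (the conjuncts $\pi(g)\sqsupseteq j\to\tau(s\succ t_j)$ are unchanged). The formula for $\succsim^{lex}_f$ is that for $\succ^{lex}_f$ with $\succ^{lex}_f$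 replaced by $\succsim^{lex}_f$ in the recursive call and $\tau(\langle\rangle\succsim^{lex}_f\langle\rangle)=\mathit{true}$. *Quasi-LPO mode:* all clauses are as in strict-LPO mode, except that for all $f,g$ (equal or not) $\tau_{1b}(s\succ g(t_1,\dots,t_m))=list(\pi(f))\wedge list(\pi(g))\wedge\Big((f>_{\mathcal F}g)\vee\big((f\approx_{\mathcal F}g)\wedge\tau(\langle s_1,\dots,s_n\rangle\succ^{lex}_{f,g}\langle t_1,\dots,t_m\rangle)\big)\Big)\wedge\bigwedge_{j}\big(\pi(g)\sqsupseteq j\to\tau(s\succ t_j)\big)$, and $\tau_{1b}(s\succsim g(t_1,\dots,t_m))$ is the same with $\succsim^{lex}_{f,g}$ instead of $\succ^{lex}_{f,g}$. Here, for $\rhd\in\{\succ,\succsim\}$, with $S_i=\langle s_i,\dots,s_n\rangle$ and $T_j=\langle t_j,\dots,t_m\rangle$ (empty if $i>n$, resp. $j>m$): if $i>n$, $\tau(S_i\succ^{lex}_{f,g}T_j)=\mathit{false}$ and $\tau(S_i\succsim^{lex}_{f,g}T_j)=\bigwedge_{j\le l\le m}\neg(\pi(g)\sqsupseteq l)$; if $i\le n$ and $j>m$, $\tau(S_i\succ^{lex}_{f,g}T_j)=\bigvee_{i\le l\le n}\pi(f)\sqsupseteq l$ and $\tau(S_i\succsim^{lex}_{f,g}T_j)=\mathit{true}$; if $i\le n$ and $j\le m$, $\tau(S_i\rhd^{lex}_{f,g}T_j)=\big(\neg(\pi(f)\sqsupseteq i)\wedge\tau(S_{i+1}\rhd^{lex}_{f,g}T_j)\big)\vee\big(\pi(f)\sqsupseteq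 i\wedge\neg(\pi(g)\sqsupseteq j)\wedge\tau(S_i\rhd^{lex}_{f,g}T_{j+1})\big)\vee\Big(\pi(f)\sqsupseteq i\wedge\pi(g)\sqsupseteq j\wedge\big(\tau(s_i\succ t_j)\vee(\tau(s_i\succsim t_j)\wedge\tau(S_{i+1}\rhd^{lex}_{f,g}T_{j+1}))\big)\Big)$. **Propositional encoding.** Let $m=|\mathcal F|$ and $k=\lceil\log_2 m\rceil$. Each $f\in\mathcal F$ has propositional variables $f_k,\dots,f_1$ ($f_k$ most significant bit), $list_f$, and $arg_f^1,\dots,arg_f^n$ where $n$ is the arity of $f$. Atoms are replaced by: $\|list(\pi(f))\|=list_f$; $\|\pi(f)\sqsupseteq i\|=arg_f^i$; $\|\pi(f)=i\|=\neg list_f\wedge arg_f^i$; $\|f\approx_{\mathcal F}g\|=\bigwedge_{1\le i\le k}(f_i\leftrightarrow g_i)$; and $\|f>_{\mathcal F}g\|=\|f>_{\mathcal F}g\|_k$ with $\|f>_{\mathcal F}g\|_1=f_1\wedge\neg g_1$ and $\|f>_{\mathcal F}g\|_k=(f_k\wedge\neg g_k)\vee\big((f_k\leftrightarrow g_k)\wedge\|f>_{\mathcal F}g\|_{k-1}\big)$ for $k>1$ (and $\|f>_{\mathcal F}g\|_0=\mathit{false}$, relevant only if $m=1$). $\mathrm{Enc}(I)$ is the conjunction of $\|\tau(s\succ t)\|$ for all $s\succ t\in I$, of $\|\tau(s\succsim t)\|$ for all $s\succsim t\in I$, and, for each $f\in\mathcal F$ of arity $n$, of $\neg list_f\to$ ''exactly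 one of $arg_f^1,\dots,arg_f^n$ is true'' (for $n=0$ the right-hand side is false). **Reading off a model $M$.** $\pi_M(f)=[\,i : M\models arg_f^i\,]$ (in increasing order) if $M\models list_f$, and otherwise $\pi_M(f)$ is the unique $i$ with $M\models arg_f^i$. Let $M(f)$ be the binary number $\langle f_k,\dots,f_1\rangle$ under $M$. In strict-LPO mode the precedence read off is the strict one with $f>_{\mathcal F}g$ iff $M(f)>M(g)$; in quasi-LPO mode it is the non-strict one with $f\ge_{\mathcal F}g$ iff $M(f)\ge M(g)$. *)

(* Defs.v *)
From mathcomp Require Import all_boot.

Set Implicit Arguments.
Unset Strict Implicit.
Unset Printing Implicit Defensive.

(* Argument positions are counted from 0 throughout: position i below is      *)
(* position i + 1 in one-based notation. Bits are numbered 1, ..., k, bit k   *)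
(* being the most significant one.                                            *)

(* Terms are untyped with respect to arities, because filtering a term        *)
(* changes the number of arguments of its symbols; [wf_term ar] singles out   *)
(* the terms that respect the arity function [ar].                            *)
Inductive term (F V : Type) : Type :=
| Var of V
| App of F & seq (term F V).
Arguments Var {F V}.
Arguments App {F V}.

Fixpoint wf_term (F V : Type) (ar : F -> nat) (t : term F V) : bool :=
  match t with
  | Var _ => true
  | App f ts => (size ts == ar f) && all (wf_term ar) ts
  end.

Inductive cmp := Gt | Ge.

Record ineq (F V : Type) := Ineq
  { ineq_cmp : cmp; ineq_lhs : term F V; ineq_rhs : term F V }.

Definition wf_ineq (F V : Type) (ar : F -> nat) (e : ineq F V) : bool :=
  wf_term ar (ineq_lhs e) && wf_term ar (ineq_rhs e).

Inductive pos_or_list :=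
| Pos of nat
| Lst of seq nat.

Definition is_filtering (F : Type) (ar : F -> nat) (pi : F -> pos_or_list) :=
  forall f, match pi f with
            | Pos i => i < ar f
            | Lst l => sorted ltn l && all (fun i => i < ar f) l
            end.

(* The default value of [nth] is irrelevant on well-formed terms.             *)
Fixpoint filter_term (F V : Type) (pi : F -> pos_or_list) (t : term F V) :
    term F V :=
  match t with
  | Var x => Var x
  | App f ts =>
      let us := map (filter_term pi) ts in
      match pi f with
      | Pos i => nth t us i
      | Lst l => App f [seq nth t us i | i <- l]
      end
  end.

Inductive lpo_mode := StrictLPO | QuasiLPO.

(* In strict mode a precedence is given by the relation >, in quasi mode by   *)
(* the relation >=.                                                           *)
Definition admitted (F : Type) (mode : lpo_mode) (R : rel F) : Prop :=
  match mode with
  | StrictLPO => irreflexive R /\ transitive R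
  | QuasiLPO => reflexive R /\ transitive R
  end.

Definition prec_gt (F : Type) (mode : lpo_mode) (R : rel F) : rel F :=
  fun f g => match mode with
             | StrictLPO => R f g
             | QuasiLPO => R f g && ~~ R g f
             end.

Definition prec_eq (F : eqType) (mode : lpo_mode) (R : rel F) : rel F :=
  fun f g => match mode with
             | StrictLPO => f == g
             | QuasiLPO => R f g && R g f
             end.

Fixpoint term_sim (F : Type) (V : eqType) (eqF : rel F) (s t : term F V) :
    bool :=
  match s, t with
  | Var x, Var y => x == y
  | App f ss, App g ts => eqF f g && all2 (term_sim eqF) ss ts
  | _, _ => false
  end.

(* The helpers taking a function argument are written as [fun .. => fix ..],  *)
(* so that the guard condition sees through them in nested recursive calls.   *)
Definition lexgt (T : Type) (gt sim : rel T) : seq T -> seq T -> bool :=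
  fix lex ss ts :=
    match ss, ts with
    | [::], _ => false
    | _ :: _, [::] => true
    | s :: ss', t :: ts' => gt s t || ((gt s t || sim s t) && lex ss' ts')
    end.

Fixpoint lpo (F : Type) (V : eqType) (gtF eqF : rel F) (s : term F V) :
    term F V -> bool :=
  match s with
  | Var _ => fun _ => false
  | App f ss =>
      fix lpo_s (t : term F V) : bool :=
        match t with
        | Var _ => false
        | App g ts =>
            all lpo_s ts &&
            (gtF f g || eqF f g && lexgt (lpo gtF eqF) (term_sim eqF) ss ts)
        end
        || has (fun si => lpo gtF eqF si t || term_sim eqF si t) ss
  end.

Definition lpo_cmp (F : eqType) (V : eqType) (mode : lpo_mode) (R : rel F)
    (c : cmp) (s t : term F V) : bool :=
  let gt := lpo (prec_gt mode R) (prec_eq mode R) in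
  let sim := term_sim (prec_eq mode R) in
  match c with
  | Gt => gt s t
  | Ge => gt s t || sim s t
  end.

Definition orients (F : eqType) (V : eqType) (mode : lpo_mode)
    (pi : F -> pos_or_list) (R : rel F) (ineqs : seq (ineq F V)) : bool :=
  all (fun e => lpo_cmp mode R (ineq_cmp e) (filter_term pi (ineq_lhs e))
                                            (filter_term pi (ineq_rhs e)))
      ineqs.

Inductive form (A : Type) : Type :=
| FTrue
| FFalse
| FAtom of A
| FNot of form A
| FAnd of form A & form A
| FOr of form A & form A
| FImp of form A & form A
| FIff of form A & form A.
Arguments FTrue {A}.
Arguments FFalse {A}.

Declare Scope form_scope.
Delimit Scope form_scope with form.
Bind Scope form_scope with form.
Notation "~ p" := (FNot p) : form_scope.
Notation "p /\ q" := (FAnd p q) : form_scope.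
Notation "p \/ q" := (FOr p q) : form_scope.
Notation "p -> q" := (FImp p q) : form_scope.
Notation "p <-> q" := (FIff p q) : form_scope.

Definition FConj (A : Type) (ps : seq (form A)) : form A :=
  foldr (@FAnd A) FTrue ps.
Definition FDisj (A : Type) (ps : seq (form A)) : form A :=
  foldr (@FOr A) FFalse ps.

Fixpoint eval (A : Type) (M : A -> bool) (p : form A) : bool :=
  match p with
  | FTrue => true
  | FFalse => false
  | FAtom a => M a
  | FNot q => ~~ eval M q
  | FAnd q r => eval M q && eval M r
  | FOr q r => eval M q || eval M r
  | FImp q r => eval M q ==> eval M r
  | FIff q r => eval M q == eval M r
  end.

Definition satisfiable (A : Type) (p : form A) : Prop :=
  exists M : A -> bool, eval M p.

Fixpoint subst_atoms (A B : Type) (h : A -> form B) (p : form A) : form B :=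
  match p with
  | FTrue => FTrue
  | FFalse => FFalse
  | FAtom a => h a
  | FNot q => FNot (subst_atoms h q)
  | FAnd q r => FAnd (subst_atoms h q) (subst_atoms h r)
  | FOr q r => FOr (subst_atoms h q) (subst_atoms h r)
  | FImp q r => FImp (subst_atoms h q) (subst_atoms h r)
  | FIff q r => FIff (subst_atoms h q) (subst_atoms h r)
  end.

Inductive atom (F : Type) : Type :=
| AGt of F & F
| AEq of F & F
| APos of F & nat
| AHas of F & nat
| AList of F.

Definition cGt (F : Type) (f g : F) : form (atom F) := FAtom (AGt f g).
Definition cEq (F : Type) (f g : F) : form (atom F) := FAtom (AEq f g).
Definition cPos (F : Type) (f : F) (i : nat) : form (atom F) :=
  FAtom (APos f i).
Definition cHas (F : Type) (f : F) (i : nat) : form (atom F) :=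
  FAtom (AHas f i).
Definition cList (F : Type) (f : F) : form (atom F) := FAtom (AList f).

(* mapi h i [:: x0; x1; ...] = [:: h i x0; h i.+1 x1; ...] *)
Definition mapi (A B : Type) (h : nat -> A -> B) : nat -> seq A -> seq B :=
  fix mapi i s :=
    match s with
    | [::] => [::]
    | x :: s' => h i x :: mapi i.+1 s'
    end.

(* [lex_strict tau c f i ss ts] is the lexicographic formula of strict mode   *)
(* for symbol f and the suffixes ss, ts starting at position i. In well-      *)
(* formed terms the two suffixes have the same length, so that the clause     *)
(* for lists of different lengths is never reached.                           *)
Definition lex_strict (F V : Type)
    (tau : term F V -> cmp -> term F V -> form (atom F)) (c : cmp) (f : F) :
    nat -> seq (term F V) -> seq (term F V) -> form (atom F) :=
  fix lex i ss ts :=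
    match ss, ts with
    | [::], [::] => if c is Gt then FFalse else FTrue
    | s :: ss', t :: ts' =>
        ((cHas f i /\ tau s Gt t)
         \/ ((cHas f i -> tau s Ge t) /\ lex i.+1 ss' ts'))%form
    | _, _ => FFalse
    end.

(* Quasi mode: ss is the suffix of the arguments of f starting at position i, *)
(* ts the suffix of the arguments of g starting at position j.                *)
Definition lex_quasi (F V : Type)
    (tau : term F V -> cmp -> term F V -> form (atom F)) (c : cmp) (f g : F) :
    nat -> seq (term F V) -> nat -> seq (term F V) -> form (atom F) :=
  fix lex i ss :=
    match ss with
    | [::] => fun j ts =>
        if c is Gt then FFalse
        else FConj (mapi (fun l _ => FNot (cHas g l)) j ts)
    | s :: ss' =>
        fix lex_ss j ts :=
          match ts with
          | [::] =>
              if c is Gt then FDisj (mapi (fun l _ => cHas f l) i ss)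
              else FTrue
          | t :: ts' =>
              ((~ cHas f i /\ lex i.+1 ss' j ts)
               \/ ((cHas f i /\ (~ cHas g j /\ lex_ss j.+1 ts'))
               \/ (cHas f i /\ (cHas g j /\
                    (tau s Gt t
                     \/ (tau s Ge t /\ lex i.+1 ss' j.+1 ts'))))))%form
          end
    end.

(* [tau mode s c t] is the constraint of s > t (c = Gt) or s >= t (c = Ge).   *)
(* When s is an application, its three disjuncts cover the cases where the    *)
(* root of t is collapsed, where both roots are kept and compared, and where  *)
(* an argument of s already dominates t.                                      *)
Fixpoint tau (F : eqType) (V : eqType) (mode : lpo_mode) (s : term F V) :
    cmp -> term F V -> form (atom F) :=
  match s with
  | Var x =>
      fix tau_x c t :=
        match c, t with
        | Gt, _ => FFalse
        | Ge, Var y => if x == y then FTrue else FFalse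
        | Ge, App g ts =>
            FDisj (mapi (fun j tj => cPos g j /\ tau_x Ge tj)%form 0 ts)
        end
  | App f ss =>
      fix tau_s c t :=
        (match t with
         | Var _ => FFalse
         | App g ts =>
             FDisj (mapi (fun j tj => cPos g j /\ tau_s c tj)%form 0 ts)
         end
         \/ (match t with
             | Var _ => FFalse
             | App g ts =>
                 let args :=
                   FConj (mapi (fun j tj => cHas g j -> tau_s Gt tj)%form 0 ts)
                 in
                 match mode with
                 | StrictLPO =>
                     if f == g then
                       (cList f /\ (lex_strict (tau mode) c f 0 ss ts
                        /\ args))%form
                     else
                       (cList f /\ (cList g /\ (cGt f g /\ args)))%form
                 | QuasiLPO =>
                     (cList f /\ (cList g /\
                      ((cGt f g
                        \/ (cEq f g /\ lex_quasi (tau mode) c f g 0 ss 0 ts))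
                      /\ args)))%form
                 end
             end
         \/ (FDisj (mapi (fun i si => cPos f i /\ tau mode si c t)%form 0 ss)
             \/ (cList f /\
                 FDisj (mapi (fun i si => cHas f i /\ tau mode si Ge t)%form
                             0 ss)))))%form
  end.

Inductive pvar (F : Type) : Type :=
| PBit of F & nat
| PList of F
| PArg of F & nat.

Definition pBit (F : Type) (f : F) (i : nat) : form (pvar F) :=
  FAtom (PBit f i).
Definition pList (F : Type) (f : F) : form (pvar F) := FAtom (PList f).
Definition pArg (F : Type) (f : F) (i : nat) : form (pvar F) :=
  FAtom (PArg f i).

Definition nbits (F : finType) : nat := up_log 2 #|F|.

Fixpoint enc_gt (F : Type) (f g : F) (k : nat) : form (pvar F) :=
  match k with
  | 0 => FFalse
  | 1 => pBit f 1 /\ ~ pBit g 1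
  | k'.+1 => (pBit f k /\ ~ pBit g k)
             \/ ((pBit f k <-> pBit g k) /\ enc_gt f g k')
  end%form.

Definition enc_eq (F : Type) (f g : F) (k : nat) : form (pvar F) :=
  FConj [seq (pBit f i <-> pBit g i)%form | i <- iota 1 k].

Definition enc_atom (F : finType) (a : atom F) : form (pvar F) :=
  match a with
  | AGt f g => enc_gt f g (nbits F)
  | AEq f g => enc_eq f g (nbits F)
  | APos f i => ~ pList f /\ pArg f i
  | AHas f i => pArg f i
  | AList f => pList f
  end%form.

Definition exactly_one (A : Type) (p : nat -> form A) (n : nat) : form A :=
  FDisj [seq (p i /\ FConj [seq (~ p j)%form | j <- iota 0 n & j != i])%form
        | i <- iota 0 n].

Definition Enc (F : finType) (ar : F -> nat) (V : eqType) (mode : lpo_mode)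
    (ineqs : seq (ineq F V)) : form (pvar F) :=
  (FConj [seq subst_atoms (@enc_atom F)
                (tau mode (ineq_lhs e) (ineq_cmp e) (ineq_rhs e)) | e <- ineqs]
   /\ FConj [seq (~ pList f -> exactly_one (pArg f) (ar f))%form
            | f <- enum F])%form.

(* If [PList f] is false, [find] returns the first position i < ar f with     *)
(* [PArg f i] true; in a model of the encoding it is the only one.            *)
Definition filtering_of (F : Type) (ar : F -> nat) (M : pvar F -> bool)
    (f : F) : pos_or_list :=
  if M (PList f) then Lst [seq i <- iota 0 (ar f) | M (PArg f i)]
  else Pos (find (fun i => M (PArg f i)) (iota 0 (ar f))).

Definition rank_of (F : finType) (M : pvar F -> bool) (f : F) : nat :=
  \sum_(1 <= i < (nbits F).+1) M (PBit f i) * 2 ^ i.-1.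

Definition precedence_of (F : finType) (mode : lpo_mode) (M : pvar F -> bool) :
    rel F :=
  fun f g => match mode with
             | StrictLPO => rank_of M f > rank_of M g
             | QuasiLPO => rank_of M f >= rank_of M g
             end.

(* Main.v *)
(** For a fixed filtering and precedence, [tau] is exact: under the valuation of
    the atoms that they induce, the formula for an inequality has the truth
    value of that inequality between the filtered terms (induction on both
    terms). In a model of the encoding, the bit formulas compare the ranks of
    the symbols, so the model satisfies the encoding iff the data read off from
    it orient all inequalities. Conversely, given any admitted precedence, rank
    each symbol by the number of symbols strictly below it; these ranks fit in
    the available bits, they preserve strict comparisons and equivalences, and
    the path order is monotone in both. *)

Require Import Defs.
From mathcomp Require Import all_boot.
From mathcomp Require Import zify.

Set Implicit Arguments.
Unset Strict Implicit.
Unset Printing Implicit Defensive.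

(** * Induction on terms, evaluation of formulas, lists of positions *)

(** The induction hypothesis ranges over argument positions, because filterings select arguments by
    [nth]; the inner induction on [ts] keeps the nested recursion guarded. *)
Lemma term_nth_ind (F V : Type) (P : term F V -> Prop) :
  (forall x, P (Var x)) ->
  (forall f ts, (forall d i, i < size ts -> P (nth d ts i)) -> P (App f ts)) ->
  forall t, P t.
Proof.
move=> PVar PApp; fix IH 1 => -[x|f ts]; first exact: PVar.
apply: PApp; elim: ts => [|t ts IHts] d [|i] lt_i.
- discriminate lt_i.
- discriminate lt_i.
- exact: IH.
- exact: IHts.
Qed.

Lemma eval_subst_atoms (A B : Type) (M : B -> bool) (h : A -> form B) p :
  eval M (subst_atoms h p) = eval (fun a => eval M (h a)) p.
Proof. by elim: p => //= [p -> | p -> q -> | p -> q -> | p -> q -> | p -> q ->]. Qed.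

Lemma eval_FConj (A : Type) (M : A -> bool) ps :
  eval M (FConj ps) = all (eval M) ps.
Proof. by elim: ps => //= p ps ->. Qed.

Lemma eval_FDisj (A : Type) (M : A -> bool) ps :
  eval M (FDisj ps) = has (eval M) ps.
Proof. by elim: ps => //= p ps ->. Qed.

Lemma mapiE (A B : Type) (h : nat -> A -> B) d i s :
  mapi h i s = [seq h (i + j) (nth d s j) | j <- iota 0 (size s)].
Proof.
elim: s i => //= x s IHs i; rewrite addn0 IHs (iotaDl 1) -map_comp.
by congr (_ :: _); apply: eq_map => j /=; rewrite addSnnS.
Qed.

(** Here and in the next two lemmas, a guarded connective over all positions of a symbol shrinks to
    the positions that the filtering keeps. *)
Lemma has_iota_eq (P : pred nat) n i :
  i < n -> has (fun j => (j == i) && P j) (iota 0 n) = P i.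
Proof.
move=> lt_in; apply/hasP/idP => [[j _ /andP[/eqP-> //]]|Pi].
by exists i; rewrite ?mem_iota ?eqxx.
Qed.

Lemma has_iota_mem (P : pred nat) n l :
  all (fun i => i < n) l -> has (fun j => (j \in l) && P j) (iota 0 n) = has P l.
Proof.
move=> /allP l_lt; apply/hasP/hasP => [[j _ /andP[lj Pj]]|[j lj Pj]].
  by exists j.
by exists j; rewrite ?mem_iota ?lj ?l_lt.
Qed.

Lemma all_iota_mem (P : pred nat) n l :
  all (fun i => i < n) l ->
  all (fun j => (j \in l) ==> P j) (iota 0 n) = all P l.
Proof.
move=> /allP l_lt; apply/allP/allP => [P_l j lj|P_l j _].
  by have := P_l j; rewrite mem_iota lj; apply; apply: l_lt.
by apply/implyP; apply: P_l.
Qed.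

(** A strictly increasing list is determined by its members. *)
Lemma sorted_filter_iota n l :
  sorted ltn l -> all (fun i => i < n) l -> l = [seq i <- iota 0 n | i \in l].
Proof.
move=> l_sorted /allP l_lt; apply: (irr_sorted_eq ltn_trans ltnn) => //.
  exact/(sorted_filter ltn_trans)/iota_ltn_sorted.
move=> i; rewrite mem_filter mem_iota /=.
by case: (boolP (i \in l)) => //= /l_lt ->.
Qed.

(* [P] is tested on positions, which are counted from [i]. *)
Fixpoint select (T : Type) (P : pred nat) i (s : seq T) : seq T :=
  if s is x :: s' then
    if P i then x :: select P i.+1 s' else select P i.+1 s'
  else [::].

Lemma select_iota (T : Type) (P : pred nat) i (s : seq T) d :
  select P i s
  = [seq nth d s (j - i) | j <- [seq j <- iota i (size s) | P j]].
Proof.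
elim: s i => //= x s IHs i; rewrite IHs.
have E : [seq nth d s (j - i.+1) | j <- iota i.+1 (size s) & P j]
       = [seq nth d (x :: s) (j - i) | j <- iota i.+1 (size s) & P j].
  apply/eq_in_map => j; rewrite mem_filter mem_iota => /andP[_ /andP[lt_ij _]].
  by rewrite -[j - i]prednK ?subn_gt0 // subnS.
by rewrite E; case: (P i) => //=; rewrite subnn.
Qed.

(** Links the two views of filtered arguments: [filter_term] enumerates the kept positions, whereas
    the lexicographic formulas walk through all positions and test each one, as [select] does. *)
Lemma select_sorted (T : Type) (s : seq T) d l :
  sorted ltn l -> all (fun i => i < size s) l ->
  [seq nth d s i | i <- l] = select (mem l) 0 s.
Proof.
move=> l_sorted l_lt; rewrite (select_iota _ _ _ d).
rewrite -(sorted_filter_iota l_sorted l_lt).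
by apply: eq_map => i; rewrite subn0.
Qed.

(** * Monotonicity of the path order in the precedence *)

Section Lpo.

Variables (F : Type) (V : eqType).
Implicit Types (gtF eqF : rel F) (s t : term F V) (ss ts : seq (term F V)).

Lemma lpo_AppE gtF eqF f ss g ts :
  lpo gtF eqF (App f ss) (App g ts)
  = all (lpo gtF eqF (App f ss)) ts &&
    (gtF f g || eqF f g && lexgt (lpo gtF eqF) (term_sim eqF) ss ts)
    || has (fun si => lpo gtF eqF si (App g ts)
                      || term_sim eqF si (App g ts)) ss.
Proof. by []. Qed.

Lemma lpo_arg gtF eqF f ss t :
  has (fun si => lpo gtF eqF si t || term_sim eqF si t) ss ->
  lpo gtF eqF (App f ss) t.
Proof. by case: t => [x|g ts] h //; rewrite lpo_AppE h orbT. Qed.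

(** Each member of [ts] is equivalent to the member of [ss] at the same position, so the subterm
    case of the order applies. *)
Lemma lpo_sim_args gtF eqF f ss ts :
  all2 (term_sim eqF) ss ts -> all (lpo gtF eqF (App f ss)) ts.
Proof.
move=> sim; suff: all (fun t => has (fun s => lpo gtF eqF s t
                                        || term_sim eqF s t) ss) ts.
  by apply: sub_all => t; apply: lpo_arg.
elim: ss ts sim => [|s ss IHss] [|t ts] //= /andP[-> /IHss sub].
rewrite orbT /=; apply: sub_all sub => t' ->; exact: orbT.
Qed.

Lemma term_sim_mono eqF eqF' : subrel eqF eqF' ->
  forall s t, term_sim eqF s t -> term_sim eqF' s t.
Proof.
move=> sub; elim/term_nth_ind=> [x|f ss IHss] [y|g ts] //=.
case/andP => /sub -> /=.
elim: ss ts IHss => [|s ss IH] [|t ts] //= IHss /andP[st all_st].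
rewrite (IHss s 0) //=; apply: IH => // d i; exact: (IHss d i.+1).
Qed.

(** Both relations occur only positively in the path order. The proof is by induction on [s] and,
    inside, on [t]. *)
Lemma lpo_mono gtF gtF' eqF eqF' :
  subrel gtF gtF' -> subrel eqF eqF' ->
  forall s t, lpo gtF eqF s t -> lpo gtF' eqF' s t.
Proof.
move=> sub_gt sub_eq; have sub_sim := term_sim_mono sub_eq.
elim/term_nth_ind=> [x|f ss IHss] //.
have sub_arg t : has (fun s => lpo gtF eqF s t || term_sim eqF s t) ss ->
    lpo gtF' eqF' (App f ss) t.
  move=> h; apply: lpo_arg; move: h; case/(has_nthP t) => i lt_i h.
  apply/(has_nthP t); exists i => //.
  by case/orP: h => [/(IHss t i lt_i)->//|/sub_sim->]; rewrite orbT.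
elim/term_nth_ind=> [x|g ts IHts]; first exact: sub_arg.
rewrite lpo_AppE => /orP[/andP[gt_ts fg]|/sub_arg //].
rewrite lpo_AppE; apply/orP; left; apply/andP; split.
  apply/(all_nthP (App f ss)) => i lt_i; apply: IHts => //.
  exact: (all_nthP _ gt_ts).
case/orP: fg => [/sub_gt->//|/andP[/sub_eq-> lex]]; rewrite /=.
(* Only the lexicographic comparison is left, by induction on the argument lists. *)
rewrite [X in _ || X](_ : _ = true) ?orbT // {gt_ts IHts sub_arg}.
elim: ss ts IHss lex => [|s ss IH] [|t ts] //= IHss.
case/orP => [/(IHss s 0 isT)/= ->//|/andP[st /IH->]].
  by case/orP: st => [/(IHss s 0 isT)/= ->//|/sub_sim->]; rewrite !orbT.
by move=> d i; apply: (IHss d i.+1).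
Qed.

End Lpo.

(** * Exactness of [tau] for a fixed filtering and precedence *)

Section Exactness.

Variables (F : finType) (ar : F -> nat) (V : eqType) (mode : lpo_mode).
Variables (pi : F -> pos_or_list) (R : rel F) (v : atom F -> bool).

Hypothesis pi_filtering : is_filtering ar pi.
Hypothesis R_admitted : admitted mode R.
Hypothesis vGt : forall f g, v (AGt f g) = prec_gt mode R f g.
(** The restriction to quasi mode matters: the bit encoding of [AEq] expresses equal ranks, which
    distinct symbols may have, while strict mode demands identity of symbols. *)
Hypothesis vEq : forall f g, mode = QuasiLPO -> v (AEq f g) = prec_eq mode R f g.
Hypothesis vList : forall f, v (AList f) = if pi f is Lst _ then true else false.
Hypothesis vPos : forall f i, i < ar f ->
  v (APos f i) = if pi f is Pos j then i == j else false.
(** In [tau], [AHas] occurs only in conjunction with [AList] for the same symbol, so its value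
    matters only when [pi f] is a list. *)
Hypothesis vHas : forall f i l, i < ar f -> pi f = Lst l ->
  v (AHas f i) = (i \in l).

Local Notation tm := (term F V).
Local Notation phi := (@filter_term F V pi).
Local Notation gt := (@lpo F V (prec_gt mode R) (prec_eq mode R)).
Local Notation sim := (@term_sim F V (prec_eq mode R)).
Local Notation cmpR := (@lpo_cmp F V mode R).
Local Notation wf := (@wf_term F V ar).
Local Notation tau := (@tau F V mode).

Definition exact_at (s : tm) c (t : tm) : Prop :=
  eval v (tau s c t) = cmpR c (phi s) (phi t).

Lemma wf_size f ts : wf (App f ts) -> size ts = ar f.
Proof. by case/andP => /eqP. Qed.

Lemma wf_nth f ts d i : wf (App f ts) -> i < size ts -> wf (nth d ts i).
Proof. by case/andP => _ /all_nthP; apply. Qed.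

Lemma filter_term_Pos f ts i d : wf (App f ts) -> pi f = Pos i ->
  i < size ts /\ phi (App f ts) = phi (nth d ts i).
Proof.
move=> wft pif; have := pi_filtering f; rewrite pif -(wf_size wft) => lt_i.
by split => //=; rewrite pif (nth_map d).
Qed.

Lemma filter_term_Lst f ts l d : wf (App f ts) -> pi f = Lst l ->
  [/\ sorted ltn l, all (fun i => i < size ts) l
    & phi (App f ts) = App f [seq phi (nth d ts i) | i <- l]].
Proof.
move=> wft pif; have := pi_filtering f; rewrite pif -(wf_size wft).
move=> /andP[sl ltl]; split => //=; rewrite pif; congr App.
by apply/eq_in_map => i /(allP ltl) lt_i; rewrite (nth_map d).
Qed.

(** Only the disjunct of the position to which [f] collapses can be true. This evaluates the
    collapsing disjuncts on either side of an inequality. *)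
Lemma eval_collapse f ts (h : tm -> form (atom F)) d : wf (App f ts) ->
  eval v (FDisj (mapi (fun j tj => FAnd (cPos f j) (h tj)) 0 ts))
  = if pi f is Pos j then eval v (h (nth d ts j)) else false.
Proof.
move=> wft; rewrite (mapiE _ d) eval_FDisj has_map.
rewrite (_ : has _ _ = has (fun j => (if pi f is Pos i then j == i else false)
                             && eval v (h (nth d ts j))) (iota 0 (size ts))).
  case pif: (pi f) => [j|l]; last by apply/hasP => -[].
  by apply: has_iota_eq; case: (filter_term_Pos d wft pif).
apply: eq_in_has => j; rewrite mem_iota (wf_size wft) /= => lt_j.
by rewrite vPos.
Qed.

Lemma eval_keep_has f ts l (h : tm -> form (atom F)) d :
  wf (App f ts) -> pi f = Lst l ->
  eval v (FDisj (mapi (fun j tj => FAnd (cHas f j) (h tj)) 0 ts))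
  = has (fun j => eval v (h (nth d ts j))) l.
Proof.
move=> wft pif; have [_ ltl _] := filter_term_Lst d wft pif.
rewrite (mapiE _ d) eval_FDisj has_map -(has_iota_mem _ ltl).
apply: eq_in_has => j; rewrite mem_iota (wf_size wft) /= => lt_j.
by rewrite (vHas lt_j pif).
Qed.

Lemma eval_keep_all f ts l (h : tm -> form (atom F)) d :
  wf (App f ts) -> pi f = Lst l ->
  eval v (FConj (mapi (fun j tj => FImp (cHas f j) (h tj)) 0 ts))
  = all (fun j => eval v (h (nth d ts j))) l.
Proof.
move=> wft pif; have [_ ltl _] := filter_term_Lst d wft pif.
rewrite (mapiE _ d) eval_FConj all_map -(all_iota_mem _ ltl).
apply: eq_in_all => j; rewrite mem_iota (wf_size wft) /= => lt_j.
by rewrite (vHas lt_j pif).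
Qed.

(** For [Ge] this is the strict lexicographic extension joined with argumentwise equivalence, the
    meaning of the non-strict lexicographic formulas. *)
Definition lexcmp c (ss ts : seq tm) : bool :=
  lexgt gt sim ss ts || (if c is Gt then false else all2 sim ss ts).

Lemma lexcmp_cons c s ss t ts :
  lexcmp c (s :: ss) (t :: ts)
  = gt s t || (gt s t || sim s t) && lexcmp c ss ts.
Proof.
by rewrite /lexcmp /=; case: (gt s t); case: (sim s t); case: c; rewrite //= orbF.
Qed.

(** A dropped position makes the formula reduce to its recursive call while [select] skips both
    heads; a kept one gives the recursion of [lexcmp_cons]. *)
Lemma eval_lex_strict c f l i ss ts :
  pi f = Lst l -> size ss = size ts -> i + size ss <= ar f -> all wf ts ->
  (forall d k, k < size ss -> forall c t, wf t -> exact_at (nth d ss k) c t) ->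
  eval v (lex_strict tau c f i ss ts)
  = lexcmp c (select (mem l) i (map phi ss)) (select (mem l) i (map phi ts)).
Proof.
move=> pif; elim: ss i ts => [|s ss IH] i [|t ts] //=; first by case: c.
move=> [sz] lt_i /andP[wft wfts] ex.
have exs := ex s 0 isT; have lt_i' : i < ar f by lia.
rewrite (vHas lt_i' pif) !exs // (IH i.+1) //; first last.
- by move=> d k; apply: (ex d k.+1).
- by lia.
case: ifP => _ //=; rewrite lexcmp_cons //.
Qed.

(** The two symbols may keep different positions, so the suffixes advance independently: the three
    disjuncts skip a dropped head of [ss], skip a dropped head of [ts], or compare two kept heads.
    Hence the nested inductions on [ss] and [ts]. *)
Lemma eval_lex_quasi c f g l l' i ss j ts :
  pi f = Lst l -> pi g = Lst l' -> i + size ss <= ar f ->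
  j + size ts <= ar g -> all wf ts ->
  (forall d k, k < size ss -> forall c t, wf t -> exact_at (nth d ss k) c t) ->
  eval v (lex_quasi tau c f g i ss j ts)
  = lexcmp c (select (mem l) i (map phi ss)) (select (mem l') j (map phi ts)).
Proof.
move=> pif pig; elim: ss i j ts => [|s ss IHss] i j ts.
  (* With [ss] exhausted, only [Ge] can hold, namely when every remaining position of [ts] is
     dropped. *)
  case: c => //= _; elim: ts j => [|t ts IHts] j //= lt_j /andP[_ wfts] ex.
  rewrite (vHas _ pig) ?IHts //; try lia.
  by case: ifP.
elim: ts j => [|t ts IHts] j.
  (* With [ts] exhausted, [Ge] always holds, and [Gt] holds iff some remaining position of [ss] is
     kept. *)
  move=> lt_i _ _ _ {IHss}; case: c => /=; last first.
    by rewrite /lexcmp /=; case: ifP => // _; case: select.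
  elim: ss s i lt_i => [|s' ss' IH] s i lt_i; rewrite /= (vHas _ pif) /=.
  - by case: ifP.
  - by move: lt_i => /=; lia.
  - by move: (IH s' i.+1) => /= -> //; [case: (i \in l) | move: lt_i => /=; lia].
  - by move: lt_i => /=; lia.
move=> lt_i lt_j /andP[wft wfts] ex.
have lt_i' : i < ar f by move: lt_i => /=; lia.
have lt_j' : j < ar g by move: lt_j => /=; lia.
(* One unfolding of the two nested fixpoints, with the recursive calls left folded. *)
have E : lex_quasi tau c f g i (s :: ss) j (t :: ts) =
          ((~ cHas f i /\ lex_quasi tau c f g i.+1 ss j (t :: ts))
               \/ ((cHas f i /\ (~ cHas g j /\ lex_quasi tau c f g i (s :: ss) j.+1 ts))
               \/ (cHas f i /\ (cHas g j /\
                    (tau s Gt t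
                     \/ (tau s Ge t /\ lex_quasi tau c f g i.+1 ss j.+1 ts))))))%form by [].
have ex' d k : k < size ss -> forall c t, wf t -> exact_at (nth d ss k) c t.
  exact: (ex d k.+1).
have exs := ex s 0 isT.
rewrite E /= (vHas lt_i' pif) (vHas lt_j' pig) !exs // {E}.
have le_i : i.+1 + size ss <= ar f by move: lt_i => /=; lia.
have le_j : j.+1 + size ts <= ar g by move: lt_j => /=; lia.
rewrite !IHss ?IHts //=; last by rewrite wft.
case: ifP => //= _; case: ifP => //= _; rewrite ?orbF // lexcmp_cons //.
Qed.

Lemma lpo_cmp_gt c s t : gt s t -> cmpR c s t.
Proof. by case: c => //= ->. Qed.

(** One shape for both comparisons. For [Ge], equivalence of the two terms can be absorbed into the
    root comparison, since by [lpo_sim_args] equivalent arguments already satisfy the side condition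
    on [ts]. *)
Lemma lpo_cmp_App c f ss g ts :
  cmpR c (App f ss) (App g ts)
  = all (gt (App f ss)) ts &&
    (prec_gt mode R f g || prec_eq mode R f g && lexcmp c ss ts)
    || has (cmpR Ge ^~ (App g ts)) ss.
Proof.
have -> : cmpR c (App f ss) (App g ts)
    = gt (App f ss) (App g ts)
      || (if c is Gt then false else sim (App f ss) (App g ts)).
  by case: c; rewrite ?orbF.
rewrite lpo_AppE /lexcmp; case: c => /=; rewrite ?orbF //.
have := @lpo_sim_args F V (prec_gt mode R) (prec_eq mode R) f ss ts.
case: (all2 _ _ _) => [->//|_]; last by rewrite andbF !orbF.
by case: (prec_gt _ _ _ _); case: (prec_eq _ _ _ _); case: lexgt; case: has.
Qed.

Definition tau_roots c f ss g ts : form (atom F) :=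
  let args := FConj (mapi (fun j tj => FImp (cHas g j) (tau (App f ss) Gt tj))
                          0 ts) in
  match mode with
  | StrictLPO =>
      if f == g then
        (cList f /\ (lex_strict tau c f 0 ss ts /\ args))%form
      else (cList f /\ (cList g /\ (cGt f g /\ args)))%form
  | QuasiLPO =>
      (cList f /\ (cList g /\
        ((cGt f g \/ (cEq f g /\ lex_quasi tau c f g 0 ss 0 ts)) /\ args)))%form
  end.

Lemma tau_App c f ss g ts :
  tau (App f ss) c (App g ts)
  = (FDisj (mapi (fun j tj => FAnd (cPos g j) (tau (App f ss) c tj)) 0 ts)
     \/ (tau_roots c f ss g ts
     \/ (FDisj (mapi (fun i si => FAnd (cPos f i) (tau si c (App g ts))) 0 ss)
     \/ (cList f /\
         FDisj (mapi (fun i si => FAnd (cHas f i) (tau si Ge (App g ts)))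
                     0 ss)))))%form.
Proof. by []. Qed.

Lemma eval_tau_roots_Pos c f ss g ts i : pi f = Pos i \/ pi g = Pos i ->
  eval v (tau_roots c f ss g ts) = false.
Proof.
rewrite /tau_roots => pifg; case: mode; last first.
  by rewrite /= !vList; case: pifg => ->; rewrite ?andbF.
case: eqP => [eq_fg|_]; rewrite /= !vList; last by case: pifg => ->; rewrite ?andbF.
by move: pifg; rewrite -eq_fg => -[] ->.
Qed.

Lemma eval_tau_roots_Lst c f ss g ts l l' :
  wf (App f ss) -> wf (App g ts) -> pi f = Lst l -> pi g = Lst l' ->
  (forall d k, k < size ss -> forall c t, wf t -> exact_at (nth d ss k) c t) ->
  (forall d k, k < size ts -> exact_at (App f ss) Gt (nth d ts k)) ->
  let us := [seq phi (nth (App f ss) ss i) | i <- l] in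
  let ws := [seq phi (nth (App g ts) ts i) | i <- l'] in
  eval v (tau_roots c f ss g ts)
  = all (gt (App f us)) ws &&
    (prec_gt mode R f g || prec_eq mode R f g && lexcmp c us ws).
Proof.
move=> wfs wft pif pig exs ext us ws.
have [sl ltl Es] := filter_term_Lst (App f ss) wfs pif.
have [sl' ltl' Et] := filter_term_Lst (App g ts) wft pig.
have wfts : all wf ts by case/andP: wft.
rewrite /tau_roots; set args := FConj _.
(* Makes [args] opaque, keeping only its truth value, so that simplification does not unfold it. *)
have {args} [args -> Eargs] : exists2 args', args = args' &
    eval v args' = all (gt (App f us)) ws.
  exists args => //; rewrite (eval_keep_all _ (App g ts) wft pig) all_map.
  apply: eq_in_all => j /(allP ltl') lt_j.
  by rewrite ext // /exact_at Es.
have selE (d : tm) us' k : sorted ltn k -> all (fun i => i < size us') k ->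
    [seq phi (nth d us' i) | i <- k] = select (mem k) 0 (map phi us').
  move=> sk ltk; rewrite -(select_sorted (phi d)) ?size_map //.
  by apply/eq_in_map => i /(allP ltk) lt_i; rewrite (nth_map d).
have szs := wf_size wfs; have szt := wf_size wft.
set A := all _ ws in Eargs *.
case Em: mode; cbv iota; rewrite -Em; last first.
  rewrite /= !vList pif pig Eargs.
  rewrite vGt vEq //.
  rewrite (@eval_lex_quasi _ _ _ l l') //; try by rewrite add0n ?szs ?szt.
  by rewrite !andTb andbC /us /ws !selE.
(* In strict mode, irreflexivity leaves only the lexicographic alternative for equal symbols;
   distinct symbols are never equivalent, which leaves only the precedence. *)
case: eqP => [eq_fg|ne_fg]; rewrite /= !vList Eargs pif.
  rewrite -eq_fg in wft pig *.
  move: pig; rewrite pif => -[El]; rewrite -El in ltl' sl'.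
  have [Rf _] : irreflexive R /\ transitive R by move: R_admitted; rewrite Em.
  have -> : prec_gt mode R f f = false by rewrite Em /= Rf.
  have -> : prec_eq mode R f f by rewrite Em /=.
  rewrite (@eval_lex_strict _ _ l) //;
    try by rewrite ?add0n szs ?szt ?eq_fg.
  by rewrite !andTb andbC /us /ws -El !selE.
move/eqP/negbTE: ne_fg => ne_fg.
have -> : prec_eq mode R f g = false by rewrite Em.
rewrite pig vGt orbF.
by rewrite !andTb andbC.
Qed.

(** Induction on [s] and, inside, on [t]; for two applications, the cases are whether each root is
    collapsed or kept. *)
Lemma eval_tau s c t : wf s -> wf t -> exact_at s c t.
Proof.
move=> wfs; elim/term_nth_ind: s wfs c t => [x|f ss IHs] wfs.
  case; first by case.
  elim/term_nth_ind => [y|g ts IHt] wft; first by rewrite /exact_at /=; case: eqP.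
  have E : tau (Var x) Ge (App g ts) =
    FDisj (mapi (fun j tj => FAnd (cPos g j) (tau (Var x) Ge tj)) 0 ts) by [].
  rewrite /exact_at E (eval_collapse _ (Var x) wft).
  case pig: (pi g) => [j|l].
    have [lt_j ->] := filter_term_Pos (Var x) wft pig.
    by apply: IHt => //; apply: wf_nth wft _.
  by have [_ _ ->] := filter_term_Lst (Var x) wft pig.
have ex d k : k < size ss -> forall c t, wf t -> exact_at (nth d ss k) c t.
  by move=> lt_k c t wft; apply: IHs => //; apply: wf_nth wfs _.
move=> c t; elim/term_nth_ind: t c => [y|g ts IHt] c wft.
  have E : tau (App f ss) c (Var y) =
    (FFalse \/ (FFalse \/
      (FDisj (mapi (fun i si => cPos f i /\ tau si c (Var y)) 0 ss)
       \/ (cList f /\ FDisj (mapi (fun i si => cHas f i /\ tau si Ge (Var y))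
                             0 ss)))))%form by [].
  rewrite /exact_at E /= (eval_collapse _ (Var y) wfs) vList {E}.
  case pif: (pi f) => [i|l].
    have [lt_i] := filter_term_Pos (Var y) wfs pif.
    by rewrite /= pif orbF => ->; apply: ex.
  rewrite (eval_keep_has _ (Var y) wfs pif).
  have [_ ltl] := filter_term_Lst (Var y) wfs pif; rewrite /= pif => -> /=.
  have -> : lpo_cmp mode R c (App f [seq phi (nth (Var y) ss i) | i <- l]) (Var y)
    = has (cmpR Ge ^~ (Var y)) [seq phi (nth (Var y) ss i) | i <- l].
    by case: c => //=; rewrite orbF.
  rewrite has_map; apply: eq_in_has => i /(allP ltl) lt_i.
  exact: ex.
have ext d k : k < size ts -> forall c, exact_at (App f ss) c (nth d ts k).
  by move=> lt_k c'; apply: IHt => //; apply: wf_nth wft _.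
rewrite /exact_at tau_App; set r := cmpR c _ _.
rewrite /= {}/r (eval_collapse _ (App g ts) wft).
rewrite (eval_collapse _ (App f ss) wfs) vList.
case pig: (pi g) => [j|l'].
  rewrite (eval_tau_roots_Pos _ _ _ (or_intror pig)) orFb.
  have [lt_j Et] := filter_term_Pos (App g ts) wft pig.
  rewrite ext // -Et.
  case pif: (pi f) => [i|l].
    have [lt_i Es] := filter_term_Pos (App f ss) wfs pif.
    (* Both roots collapse: the two surviving disjuncts express the same comparison. *)
    by rewrite ex // -Es orbF orbb.
  rewrite (eval_keep_has _ (App f ss) wfs pif) andTb.
  have [_ ltl Es] := filter_term_Lst (App f ss) wfs pif.
  (* Only the root of [t] collapses: the disjunct for a dominating argument of [s] is absorbed,
     because it implies that the filtered [s] is greater than the filtered [t]. *)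
  apply/orb_idr => /hasP[i li]; rewrite ex ?(allP ltl) // => ge_i.
  apply: lpo_cmp_gt; rewrite Es; apply: lpo_arg; rewrite has_map.
  by apply/hasP; exists i.
rewrite orFb; case pif: (pi f) => [i|l].
  rewrite (eval_tau_roots_Pos _ _ _ (or_introl pif)) orFb orbF.
  have [lt_i Es] := filter_term_Pos (App f ss) wfs pif.
  by rewrite ex // -Es.
rewrite (eval_tau_roots_Lst _ wfs wft pif pig) //; last by move=> *; apply: ext.
rewrite (eval_keep_has _ (App f ss) wfs pif) andTb.
have [_ ltl ->] := filter_term_Lst (App f ss) wfs pif.
have [_ ltl' Et] := filter_term_Lst (App g ts) wft pig.
rewrite Et lpo_cmp_App; congr (_ || _); rewrite has_map.
by apply: eq_in_has => i /(allP ltl) lt_i; rewrite ex //= -/(phi (App g ts)) Et.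
Qed.

End Exactness.

(** * Binary numbers and the bit formulas *)

(** [rank_of] is the instance [k = nbits F]; a free [k] allows induction on the number of bits. *)
Definition bits_value (b : nat -> bool) k := \sum_(1 <= i < k.+1) b i * 2 ^ i.-1.

Lemma bits_valueS b k : bits_value b k.+1 = bits_value b k + b k.+1 * 2 ^ k.
Proof. by rewrite /bits_value big_nat_recr. Qed.

Lemma bits_value_lt b k : bits_value b k < 2 ^ k.
Proof.
elim: k => [|k IHk]; first by rewrite /bits_value big_geq.
by rewrite bits_valueS expnS; case: (b _); lia.
Qed.

Lemma bits_value_odd r k :
  bits_value (fun i => odd (r %/ 2 ^ i.-1)) k = r %% 2 ^ k.
Proof.
elim: k => [|k IHk]; first by rewrite /bits_value big_geq // modn1.
rewrite bits_valueS IHk /= expnS.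
have lt_sum : odd (r %/ 2 ^ k) * 2 ^ k + r %% 2 ^ k < 2 * 2 ^ k.
  have: r %% 2 ^ k < 2 ^ k by rewrite ltn_mod expn_gt0.
  by case: odd; lia.
(* Splitting the quotient of [r] by [2 ^ k] into its double half and its parity, the former
   contributes a multiple of [2 ^ k.+1], which vanishes in the remainder. *)
rewrite addnC [in RHS](divn_eq r (2 ^ k)) -[in RHS](odd_double_half (r %/ 2 ^ k)).
by rewrite -muln2 mulnDl addnAC -mulnA [X in _ = X %% _]addnC modnMDl (modn_small lt_sum).
Qed.

(** The lower [k] bits sum to less than [2 ^ k], so differing top bits decide and equal ones
    cancel. *)
Lemma eval_enc_gt (F : Type) (M : pvar F -> bool) f g k :
  eval M (enc_gt f g k)
  = (bits_value (fun i => M (PBit g i)) k < bits_value (fun i => M (PBit f i)) k).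
Proof.
elim: k => [|k IHk]; first by rewrite /bits_value !big_geq.
(* The general recursion also covers the separate clause for one bit, as [enc_gt f g 0] is false. *)
have -> : eval M (enc_gt f g k.+1)
   = M (PBit f k.+1) && ~~ M (PBit g k.+1)
     || (M (PBit f k.+1) == M (PBit g k.+1)) && eval M (enc_gt f g k).
  by case: k {IHk} => //=; rewrite andbF orbF.
rewrite IHk !bits_valueS.
have := bits_value_lt (fun i => M (PBit f i)) k.
have := bits_value_lt (fun i => M (PBit g i)) k.
by case: (M (PBit f _)); case: (M (PBit g _)); rewrite /= => *; lia.
Qed.

Lemma eval_enc_eq (F : Type) (M : pvar F -> bool) f g k :
  eval M (enc_eq f g k)
  = (bits_value (fun i => M (PBit f i)) k == bits_value (fun i => M (PBit g i)) k).
Proof.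
rewrite /enc_eq eval_FConj all_map.
elim: k => [|k IHk]; first by rewrite /bits_value !big_geq.
rewrite -[k.+1]addn1 iotaD all_cat IHk /= addn1 add1n andbT !bits_valueS.
have := bits_value_lt (fun i => M (PBit f i)) k.
have := bits_value_lt (fun i => M (PBit g i)) k.
by case: (M (PBit f _)); case: (M (PBit g _)); rewrite /= => *; lia.
Qed.

Lemma eval_exactly_one (A : Type) (M : A -> bool) p n :
  reflect (exists2 i, i < n & forall j, j < n -> eval M (p j) = (j == i))
          (eval M (exactly_one p n)).
Proof.
rewrite /exactly_one eval_FDisj has_map; apply: (iffP hasP) => -[i].
  rewrite mem_iota => lt_i /= /andP[pi]; rewrite eval_FConj all_map => /allP un.
  exists i => // j lt_j; case: eqP => [-> //|/eqP ne_ji].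
  by apply/negbTE; apply: un; rewrite mem_filter mem_iota ne_ji.
move=> lt_i pE; exists i; first by rewrite mem_iota.
rewrite /= pE // eqxx eval_FConj all_map; apply/allP => j.
by rewrite mem_filter mem_iota /= => /andP[/negbTE ne_ji lt_j]; rewrite pE // ne_ji.
Qed.

(** * From models to filterings and precedences, and back *)

Section Models.

Variables (F : finType) (ar : F -> nat).
Implicit Types (M : pvar F -> bool) (pi : F -> pos_or_list) (R : rel F).

Definition encodes_filtering M pi : Prop := forall f,
  M (PList f) = (if pi f is Lst _ then true else false) /\
  forall i, i < ar f ->
    M (PArg f i) = match pi f with Pos j => i == j | Lst l => i \in l end.

Lemma admitted_precedence_of mode M : admitted mode (precedence_of mode M).
Proof.
by case: mode; split=> [f|g f h]; rewrite /precedence_of /=; lia.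
Qed.

(** Serves both directions: [pi] is either read off from a model or the given filtering from which a
    model is built. The reason is [eval_tau], applied to the valuation of atoms that [M] induces
    through [enc_atom]. *)
Lemma eval_Enc (V : eqType) mode M pi (ineqs : seq (ineq F V)) :
  all (wf_ineq ar) ineqs -> is_filtering ar pi -> encodes_filtering M pi ->
  eval M (Enc ar mode ineqs) = orients mode pi (precedence_of mode M) ineqs.
Proof.
move=> wf_ineqs pi_filt enc_pi; rewrite /Enc /= !eval_FConj !all_map.
(* The exactly-one conjuncts hold because [M] encodes a filtering. *)
rewrite [X in _ && X](_ : _ = true) ?andbT; last first.
  apply/allP => f _ /=; have [-> argE] := enc_pi f; have := pi_filt f.
  case: (pi f) argE => // i argE lt_i.
  by apply/eval_exactly_one; exists i.
elim: ineqs wf_ineqs => //= e es IH /andP[/andP[wfl wfr] /IH->].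
congr (_ && _); rewrite eval_subst_atoms.
have rankE f : rank_of M f = bits_value (fun i => M (PBit f i)) (nbits F) by [].
rewrite (@eval_tau _ ar _ _ pi (precedence_of mode M)) //.
- exact: admitted_precedence_of.
- move=> f g; rewrite /= eval_enc_gt -!rankE /prec_gt /precedence_of.
  by case: mode {IH} => //; lia.
- move=> f g ->; rewrite /= eval_enc_eq -!rankE; lia.
- by move=> f /=; have [-> _] := enc_pi f.
- move=> f i lt_i /=; have [-> /(_ i lt_i)->] := enc_pi f.
  by case: (pi f).
- move=> f i l lt_i pif /=; have [_ /(_ i lt_i)->] := enc_pi f.
  by rewrite pif.
Qed.

Lemma model_filtering (V : eqType) mode M (ineqs : seq (ineq F V)) :
  eval M (Enc ar mode ineqs) ->
  is_filtering ar (filtering_of ar M) /\ encodes_filtering M (filtering_of ar M).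
Proof.
rewrite /Enc /= => /andP[_]; rewrite eval_FConj all_map => /allP one.
suff H f : (match filtering_of ar M f with
              | Pos i => i < ar f
              | Lst l => sorted ltn l && all (fun i => i < ar f) l
              end : bool) /\
           (M (PList f) = (if filtering_of ar M f is Lst _ then true else false) /\
            forall i, i < ar f -> M (PArg f i) =
              match filtering_of ar M f with Pos j => i == j | Lst l => i \in l end).
  by split=> f; case: (H f).
have := one f (mem_enum _ _); rewrite /filtering_of /=.
case: (M (PList f)) => /= [_|/eval_exactly_one[i lt_i argE]].
  split; [apply/andP; split | split=> // i lt_i].
  - exact/(sorted_filter ltn_trans)/iota_ltn_sorted.
  - by apply/allP => i; rewrite mem_filter mem_iota => /and3P[].
  - by rewrite mem_filter mem_iota /= add0n lt_i andbT.
(* [find] stops at a position whose variable is true, and by [argE] the only such position is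
   [i]. *)
suff -> : find (fun j => M (PArg f j)) (iota 0 (ar f)) = i by [].
have has_arg : has (fun j => M (PArg f j)) (iota 0 (ar f)).
  by apply/hasP; exists i; rewrite ?mem_iota //; have /= -> := argE i lt_i.
have lt_k := has_arg; rewrite has_find size_iota in lt_k.
have := nth_find 0 has_arg; rewrite nth_iota // add0n.
by have /= -> := argE _ lt_k => /eqP.
Qed.

Definition height mode R f := #|[pred g | prec_gt mode R f g]|.

Lemma prec_gt_irr mode R : admitted mode R -> irreflexive (prec_gt mode R).
Proof. by case: mode => -[irr _] f //=; rewrite andbN. Qed.

Lemma prec_gt_trans mode R : admitted mode R -> transitive (prec_gt mode R).
Proof.
case: mode => -[_ tr] g f h /=; first exact: tr.
case/andP=> fg gf /andP[gh hg].
by rewrite (tr _ _ _ fg gh); apply: contra gf => hf; apply: tr gh hf.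
Qed.

(** By transitivity all symbols below [g] are below [f]; the inclusion is proper because [g] itself
    is below [f] but not below [g]. *)
Lemma height_gt mode R f g : admitted mode R -> prec_gt mode R f g ->
  height mode R g < height mode R f.
Proof.
move=> adm fg; apply: proper_card; apply/properP; split.
  by apply/subsetP => h; rewrite !inE; apply: prec_gt_trans.
by exists g; rewrite !inE // prec_gt_irr.
Qed.

Lemma height_eq mode R f g : admitted mode R -> prec_eq mode R f g ->
  height mode R f = height mode R g.
Proof.
case: mode => [_ /eqP-> //|[_ tr] /andP[fg gf]]; apply: eq_card => h; rewrite !inE /=.
congr (_ && ~~ _); apply/idP/idP => [fh|gh].
- exact: tr gf fh.
- exact: tr fg gh.
- exact: (tr f).
- exact: (tr g).
Qed.

(** No symbol is below itself, so the height is less than the number of symbols, which is at most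
    [2 ^ nbits F]. *)
Lemma height_lt mode R f : admitted mode R -> height mode R f < 2 ^ nbits F.
Proof.
move=> adm; apply: leq_trans (up_logP _ _) => //; apply: proper_card.
by apply/properP; split; [exact/subsetP | exists f; rewrite ?inE ?prec_gt_irr].
Qed.

Definition model_of pi mode R (a : pvar F) : bool :=
  match a with
  | PBit f i => odd (height mode R f %/ 2 ^ i.-1)
  | PList f => if pi f is Lst _ then true else false
  | PArg f i => match pi f with Pos j => i == j | Lst l => i \in l end
  end.

Lemma rank_of_model pi mode R f : admitted mode R ->
  rank_of (model_of pi mode R) f = height mode R f.
Proof.
move=> adm; rewrite -(modn_small (height_lt f adm)) -bits_value_odd //.
Qed.

(** The precedence by heights may relate symbols that [R] leaves incomparable. It suffices that it
    extends both the strict part and the equivalence of [R], by [lpo_mono] and [term_sim_mono]. *)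
Lemma orients_model (V : eqType) pi mode R (ineqs : seq (ineq F V)) :
  admitted mode R -> orients mode pi R ineqs ->
  orients mode pi (precedence_of mode (model_of pi mode R)) ineqs.
Proof.
move=> adm; set R' := precedence_of _ _.
have sub_gt : subrel (prec_gt mode R) (prec_gt mode R').
  move=> f g /(height_gt adm); rewrite /R' /prec_gt /precedence_of.
  by case: mode @R' adm => R' adm; rewrite !rank_of_model //; lia.
have sub_eq : subrel (prec_eq mode R) (prec_eq mode R').
  move=> f g fg; have := height_eq adm fg; move: fg.
  rewrite /R' /prec_eq /precedence_of.
  by case: mode @R' adm {sub_gt} => R' adm //; rewrite !rank_of_model //; lia.
apply: sub_all => -[c s t]; rewrite /lpo_cmp /=.
by case: c => [|/orP[|/(term_sim_mono sub_eq)->]];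
  rewrite ?orbT // => /(lpo_mono sub_gt sub_eq) ->.
Qed.

End Models.

Theorem mainTheorem2 (F : finType) (ar : F -> nat) (V : eqType)
    (mode : lpo_mode) (ineqs : seq (ineq F V))
    (wf_ineqs : all (wf_ineq ar) ineqs) :
  ((exists (pi : F -> pos_or_list) (R : rel F),
      [/\ is_filtering ar pi, admitted mode R & orients mode pi R ineqs])
   <-> satisfiable (Enc ar mode ineqs))
  /\ (forall M : pvar F -> bool, eval M (Enc ar mode ineqs) ->
        [/\ is_filtering ar (filtering_of ar M),
            admitted mode (precedence_of mode M)
          & orients mode (filtering_of ar M) (precedence_of mode M) ineqs]).
Proof.
have sound (M : pvar F -> bool) : eval M (Enc ar mode ineqs) ->
    [/\ is_filtering ar (filtering_of ar M),
        admitted mode (precedence_of mode M)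
      & orients mode (filtering_of ar M) (precedence_of mode M) ineqs].
  move=> sat; have [filt enc] := model_filtering sat.
  split=> //; first exact: admitted_precedence_of.
  by rewrite -(eval_Enc mode wf_ineqs filt enc).
split=> //; split=> [[pi [R [filt adm ori]]]|[M /sound]]; last first.
  by exists (filtering_of ar M), (precedence_of mode M).
(* [model_of] encodes [pi] by its very definition. *)
exists (model_of pi mode R); rewrite (eval_Enc mode wf_ineqs filt); last by [].
exact: orients_model.
Qed.
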